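(* Let $\bar z\in\Omega$ be an optimal solution of (CLP). Assume that $\beta$-FR is satisfied at $\bar z$ for some $\beta>0$. Then there exists $u\in L^\infty([0,T];\mathbb{R}^m)$ such that $$c(t)+\sum_{i\in I_0(t)}u_i(t)a_i(t)=0\ \text{ for a.e. } t\in[0,T],$$ $$u_i(t)\ge 0\ \text{ for a.e. } t\in[0,T],\ i\in I.$$
   Context: Setting: $T>0$, and $A:[0,T]\to\mathbb{R}^{m\times n}$, $b:[0,T]\to\mathbb{R}^m$, $c:[0,T]\to\mathbb{R}^n$ have measurable, essentially bounded entries; thus there is $K>0$ with $\|A(t)\|,\|b(t)\|,\|c(t)\|\le K$ for a.e. $t$. Let $I=\{1,\dots,m\}$ and let $a_i(t)^\top$ be the $i$-th row of $A(t)$. Problem (CLP): minimize $F(z)=\int_0^T c(t)^\top z(t)\,dt$ over the feasible set $\Omega=\{z\in L^\infty([0,T];\mathbb{R}^n): A(t)z(t)\le b(t)\text{ a.e. in }[0,T]\}$ (inequalities componentwise). $\bar z\in\Omega$ is an optimal solution if $F(\bar z)\le F(z)$ for all $z\in\Omega$. For $\mathcal I\subset I$, $A^{\mathcal I}(t)$ is the matrix obtained from $A(t)$ by keeping only the rows with index in $\mathcal I$. The determinant of the $0\times 0$ matrix is $1$. Given $\bar z\in\Omega$ and $\beta>0$, $I_\beta(t)=\{i\in I: -\beta\le a_i(t)^\top\bar z(t)-b_i(t)\le 0\}$ ($\beta$-active constraints) and $I_0(t)=\{i\in I: a_i(t)^\top\bar z(t)-b_i(t)=0\}$ (active constraints).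 $\beta$-FR is satisfied at $\bar z\in\Omega$ if there is a constant $\hat K>0$ such that $\det\big(A^{I_\beta(t)}(t)A^{I_\beta(t)}(t)^\top\big)\ge\hat K$ for a.e. $t\in[0,T]$. *)

(* Defs.v *)
From mathcomp Require Import all_boot all_order all_algebra.
From mathcomp Require Import all_classical all_reals all_analysis.

Set Implicit Arguments.
Unset Strict Implicit.
Unset Printing Implicit Defensive.
Import Order.TTheory GRing.Theory Num.Theory.
Import numFieldNormedType.Exports.
Local Open Scope classical_set_scope.
Local Open Scope ring_scope.

(* The line with the sigma-algebra of Lebesgue measurable sets (instead of the
   Borel one carried by R), which is the domain of completed_lebesgue_measure. *)
Notation lebesgueType R :=
  (caratheodory_type (@wlength R idfun)^*%mu) (only parsing).
Notation leb R := (@completed_lebesgue_measure R) (only parsing).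

Definition horizon (R : realType) (T : R) : set (lebesgueType R) :=
  [set t : R | 0 <= t <= T].

(* Functions on [0, T] are total functions on R whose values outside [0, T] are
   never used: \_ extends by 0 the restriction of f to [0, T]. *)
Definition Linfty (R : realType) (T : R) (f : R -> R) : Prop :=
  ((f : lebesgueType R -> R) \_ (horizon T)) \in Lfun (leb R) +oo%E.

Definition Linfty_mx (R : realType) (T : R) (p q : nat)
    (M : R -> 'M[R]_(p, q)) : Prop :=
  forall i j, Linfty T (fun t => M t i j).

Definition ae_horizon (R : realType) (T : R) (P : R -> Prop) : Prop :=
  \forall t \ae leb R, horizon T t -> P t.

Section CLP.
Context (R : realType) (m n : nat) (T : R).
Variables (A : R -> 'M[R]_(m, n)) (b : R -> 'cV[R]_m) (c : R -> 'cV[R]_n).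
Implicit Types (z : R -> 'cV[R]_n) (t beta : R).

Definition feasible z : Prop :=
  Linfty_mx T z /\
  ae_horizon T (fun t => forall i : 'I_m, (A t *m z t) i 0 <= b t i 0).

Definition cost z : R :=
  \int[leb R]_(t in horizon T) ((c t)^T *m z t) 0 0.

Definition optimal zbar : Prop :=
  feasible zbar /\ forall z, feasible z -> cost zbar <= cost z.

Definition residual z t (i : 'I_m) : R := (A t *m z t) i 0 - b t i 0.

Definition beta_active z beta t : {set 'I_m} :=
  [set i | - beta <= residual z t i <= 0]%SET.

Definition active z t : {set 'I_m} := [set i | residual z t i == 0]%SET.

Definition keep_rows (M : 'M[R]_(m, n)) (J : {set 'I_m}) : 'M[R]_(#|J|, n) :=
  rowsub (fun k : 'I_#|J| => enum_val k) M.

Definition beta_FR z beta : Prop :=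
  exists2 K : R, 0 < K &
    ae_horizon T (fun t =>
      let AJ := keep_rows (A t) (beta_active z beta t) in
      K <= \det (AJ *m AJ^T)).

End CLP.

(* Main.v *)
(** Let J(t) be the set of beta-active indices, B(t) the rows of A(t) indexed by
    J(t), and H(t) the inverse of B B^T; by beta-FR it is essentially bounded.
    The least-squares multiplier v = - H B c makes p = c + B^T v the projection
    of c on ker B.  With s = (b - A zbar)_J >= 0 the slack and e = min(v, s)
    componentwise, the direction w = B^T H e - p satisfies B w = e and
    c^T w = - (|p|^2 + v^T e), where v_k min(v_k, s_k) >= 0.  For small eps > 0,
    zbar + eps w is feasible: on J because eps e <= s, off J because the slack
    exceeds beta.  Optimality of zbar then forces p = 0 and
    v_k min(v_k, s_k) = 0 a.e.; the latter says v_k >= 0, and v_k = 0 unless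
    s_k = 0. *)

Require Import Defs.
From mathcomp Require Import all_boot all_order all_algebra.
From mathcomp Require Import all_classical all_reals all_analysis.
From mathcomp Require Import measurable_realfun ess_sup_inf.
Import Order.TTheory GRing.Theory Num.Theory.
Import numFieldNormedType.Exports.
Local Open Scope ring_scope.

Set Implicit Arguments.
Unset Strict Implicit.
Unset Printing Implicit Defensive.

(** * Essentially bounded functions on the horizon *)

Section Linfty_algebra.
Local Open Scope classical_set_scope.
Context (R : realType) (T : R).
Implicit Types f g : R -> R.
Local Notation D := (horizon T).

Lemma horizonE : D = `[0, T] :> set R.
Proof. by apply/seteqP; split => t; rewrite /= in_itv. Qed.

Lemma measurable_horizon : measurable D.
Proof.
suff : (@measurable _ (measurableTypeR R)) D.
  exact: (@sub_caratheodory _ _ R (@wlength R idfun)).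
by rewrite horizonE; exact: measurable_itv.
Qed.

Lemma leb_horizon_lty : (leb R D < +oo)%E.
Proof.
(* Both measures are restrictions of the same outer measure. *)
suff : (@lebesgue_measure R D < +oo)%E by [].
rewrite horizonE lebesgue_measure_itv/=.
by case: ifP => // _; rewrite -EFinB ltry.
Qed.

Lemma ae_horizonW (P : R -> Prop) : (forall t, D t -> P t) -> ae_horizon T P.
Proof. by move=> h; apply: aeW => t; exact: h. Qed.

Lemma ae_horizonS (P Q : R -> Prop) : (forall t, D t -> P t -> Q t) ->
  ae_horizon T P -> ae_horizon T Q.
Proof.
by move=> PQ; rewrite /ae_horizon; apply: filterS => t h Dt; exact/PQ/h.
Qed.

Lemma ae_horizonS2 (P Q S : R -> Prop) :
  (forall t, D t -> P t -> Q t -> S t) ->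
  ae_horizon T P -> ae_horizon T Q -> ae_horizon T S.
Proof.
move=> PQS; rewrite /ae_horizon; apply: filterS2 => t hP hQ Dt.
by apply: PQS => //; [exact: hP|exact: hQ].
Qed.

Lemma LinftyP f : Linfty T f <->
  measurable_fun D (f : lebesgueType R -> R) /\
  exists M : R, ae_horizon T (fun t => `|f t| <= M).
Proof.
have mD := measurable_horizon.
(* The norm of order infinity is defined by cases on whether the whole line has positive measure; if
   it has not, every property holds almost everywhere. *)
have nearT (P : R -> Prop) : ~~ (0 < leb R setT)%E -> \forall t \ae leb R, P t.
  rewrite -leNgt => h; exists setT; split => //.
  by apply/eqP; rewrite eq_le h measure_ge0.
rewrite /Linfty; split.
- move=> /andP[]; rewrite !inE => mf; rewrite /finite_norm unlock => nf.
  split; first by apply/(measurable_restrictT _ mD).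
  move: nf => /=; case: ifPn => [_ nf|mu0 _].
    have [M hM] := @ess_supr_bounded _ _ _ (leb R) (fun t => `|(f \_ D) t|) nf.
    exists M; apply: filterS hM => t /= h Dt.
    by move: h; rewrite patchE mem_set.
  by exists 0; exact: nearT.
- move=> [mf [M hM]]; apply/andP; split; rewrite !inE.
    by apply/(measurable_restrictT _ mD).
  rewrite /= /finite_norm unlock; case: ifPn => // _.
  (* [M] can be negative when the horizon is null, whereas the extension by zero takes the value 0;
     hence the maximum with 0. *)
  apply: (@le_lt_trans _ _ (Num.max M 0)%:E); last exact: ltry.
  apply/ess_supP; move: hM; rewrite /ae_horizon; apply: filterS => t /= h.
  rewrite lee_fin patchE; case: ifPn => [/set_mem/h|_].
    by rewrite le_max => ->.
  by rewrite normr0 le_max lexx orbT.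
Qed.

Lemma Linfty_cst (k : R) : Linfty T (fun=> k).
Proof.
apply/LinftyP; split; first exact: measurable_cst.
by exists `|k|; apply: ae_horizonW.
Qed.

Lemma LinftyD f g : Linfty T f -> Linfty T g -> Linfty T (fun t => f t + g t).
Proof.
move=> /LinftyP[mf [M hM]] /LinftyP[mg [N hN]]; apply/LinftyP; split.
  exact: measurable_funD.
exists (M + N); apply: ae_horizonS2 hM hN => t _ hf hg.
by rewrite (le_trans (ler_normD _ _))// lerD.
Qed.

Lemma LinftyM f g : Linfty T f -> Linfty T g -> Linfty T (fun t => f t * g t).
Proof.
move=> /LinftyP[mf [M hM]] /LinftyP[mg [N hN]]; apply/LinftyP; split.
  exact: measurable_funM.
exists (M * N); apply: ae_horizonS2 hM hN => t _ hf hg.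
by rewrite normrM ler_pM.
Qed.

Lemma LinftyN f : Linfty T f -> Linfty T (fun t => - f t).
Proof.
move=> fT; have := LinftyM (Linfty_cst (-1)) fT.
by under eq_fun do rewrite mulN1r.
Qed.

Lemma LinftyB f g : Linfty T f -> Linfty T g -> Linfty T (fun t => f t - g t).
Proof. by move=> fT /LinftyN; exact: LinftyD. Qed.

Lemma Linfty_norm f : Linfty T f -> Linfty T (fun t => `|f t|).
Proof.
move=> /LinftyP[mf [M hM]]; apply/LinftyP; split.
  by apply: measurableT_comp => //; exact: normr_measurable.
by exists M; apply: ae_horizonS hM => t _; rewrite normr_id.
Qed.

Lemma Linfty_sum I (r : seq I) (P : pred I) (F : I -> R -> R) :
  (forall i, P i -> Linfty T (F i)) ->
  Linfty T (fun t => \sum_(i <- r | P i) F i t).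
Proof.
move=> FT; elim: r => [|i r IH].
  by under eq_fun do rewrite big_nil; exact: Linfty_cst.
under eq_fun do rewrite big_cons.
by have := FT i; case: (P i) => [/(_ isT)/LinftyD|_]; exact.
Qed.

Lemma Linfty_prod I (r : seq I) (P : pred I) (F : I -> R -> R) :
  (forall i, P i -> Linfty T (F i)) ->
  Linfty T (fun t => \prod_(i <- r | P i) F i t).
Proof.
move=> FT; elim: r => [|i r IH].
  by under eq_fun do rewrite big_nil; exact: Linfty_cst.
under eq_fun do rewrite big_cons.
by have := FT i; case: (P i) => [/(_ isT)/LinftyM|_]; exact.
Qed.

Lemma Linfty_min f g : Linfty T f -> Linfty T g ->
  Linfty T (fun t => Num.min (f t) (g t)).
Proof.
move=> /LinftyP[mf [M hM]] /LinftyP[mg [N hN]]; apply/LinftyP; split.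
  exact: measurable_minr.
exists (Num.max M N); apply: ae_horizonS2 hM hN => t _ hf hg.
by rewrite le_max; case: (leP (f t) (g t)) => _; rewrite ?hf ?hg ?orbT.
Qed.

(** Truncation from below at [K] bounds the reciprocal by [K^-1] at every time, even where [f]
    vanishes; measurability comes from that of the power with exponent -1. *)
Lemma Linfty_inv_max (K : R) f : 0 < K -> Linfty T f ->
  Linfty T (fun t => (Num.max (f t) K)^-1).
Proof.
move=> K0 /LinftyP[mf _]; have gt0 t : 0 < Num.max (f t) K.
  by rewrite lt_max K0 orbT.
apply/LinftyP; split.
  rewrite [X in measurable_fun _ X](_ : _ =
    (@powR R ^~ (-1)) \o (fun t => Num.max (f t) K)); last first.
    by apply/funext => t; rewrite /= powR_inv1// ltW.
  apply: measurableT_comp; first exact: measurable_powR.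
  apply: measurable_maxr => //.
exists K^-1; apply: ae_horizonW => t _.
have tp : 0 <= (Num.max (f t) K)^-1 by rewrite invr_ge0 ltW.
by rewrite ger0_norm// lef_pV2 ?posrE// le_max lexx orbT.
Qed.

Lemma Linfty_ler f g : Linfty T f -> Linfty T g ->
  Linfty T (fun t => (f t <= g t)%R%:R).
Proof.
move=> /LinftyP[mf _] /LinftyP[mg _]; apply/LinftyP; split.
  have mD := measurable_horizon.
  rewrite [X in measurable_fun _ X](_ : _ =
    fun t => if f t <= g t then 1 else 0); last first.
    by apply/funext => t; case: ifP.
  apply: measurable_fun_if.
  - exact: measurable_horizon.
  - exact: measurable_fun_ler.
  - exact: measurable_cst.
  - exact: measurable_cst.
by exists 1; apply: ae_horizonW => t _; case: (f t <= g t)%R;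
  rewrite ?normr0 ?normr1.
Qed.

Lemma Linfty_integrable f : Linfty T f -> (leb R).-integrable D (EFin \o f).
Proof.
move=> /LinftyP[mf [M hM]]; apply/integrableP; split.
  exact/measurable_EFinP.
apply: le_lt_trans.
  apply: (@integral_le_bound _ _ _ (leb R) D _ `|M|%:E) => //.
  - exact: measurable_horizon.
  - exact/measurable_EFinP.
  - move: hM; rewrite /ae_horizon; apply: filterS => t h /h /= h'.
    by rewrite lee_fin (le_trans h')// ler_norm.
by rewrite lte_mul_pinfty// leb_horizon_lty.
Qed.

(** As [f] equals its absolute value almost everywhere, the integral of the latter is nonpositive,
    hence zero. *)
Lemma Linfty_ae0 f : Linfty T f -> ae_horizon T (fun t => 0 <= f t) ->
  \int[leb R]_(t in D) f t <= 0 -> ae_horizon T (fun t => f t = 0).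
Proof.
move=> fT f0 If; have mD := measurable_horizon.
have mf : measurable_fun D (EFin \o f).
  by apply/measurable_EFinP; case/LinftyP: fT.
have fI := Linfty_integrable fT.
suff /(ae_eq_integral_abs (leb R) mD mf) :
    (\int[leb R]_(x in D) `|(EFin \o f) x| = 0)%E.
  by apply: filterS => t /= h /h [].
apply/eqP; rewrite eq_le integral_ge0// andbT.
have -> := @ae_eq_integral _ _ _ (leb R) D (EFin \o f) (abse \o (EFin \o f)) mD.
- by rewrite -[leLHS](fineK (integrable_fin_num mD fI)) lee_fin.
- exact: measurableT_comp.
- exact: mf.
- move: f0; rewrite /ae_horizon; apply: filterS => t /= h /h ht.
  by rewrite ger0_norm.
Qed.
End Linfty_algebra.

(** One constant serves all entries: the sum of their absolute values is essentially bounded and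
    dominates each of them. *)
Lemma Linfty_mx_bounded (R : realType) (T : R) p (x : R -> 'cV[R]_p) :
  Linfty_mx T x ->
  exists2 M : R, 0 <= M & ae_horizon T (fun t => forall i, `|x t i 0| <= M).
Proof.
move=> xT; have /LinftyP[_ [M hM]] : Linfty T (fun t => \sum_i `|x t i 0|).
  by apply: Linfty_sum => i _; apply: Linfty_norm; exact: xT.
exists `|M| => //; apply: ae_horizonS hM => t _ h i.
apply: le_trans (ler_norm M); apply: le_trans (le_trans (ler_norm _) h).
by rewrite (bigD1 i)//= lerDl sumr_ge0.
Qed.

(** * Gluing along a map with finitely many values *)

Section Linfty_select.
Context (R : realType) (T : R) (m : nat) (X : R -> {set 'I_m}).
Hypothesis XT : forall i, Linfty T (fun t => (i \in X t)%:R).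

Lemma Linfty_eq_set (J : {set 'I_m}) : Linfty T (fun t => (X t == J)%:R).
Proof.
(* Equality of sets is tested index by index: each factor is the indicator that [X t] and [J] agree
   at [i]. *)
have -> : (fun t => (X t == J)%:R) = fun t : R =>
    \prod_i if i \in J then (i \in X t)%:R else 1 - (i \in X t)%:R :> R.
  apply/funext => t; have [->|/eqP XJ] := eqVneq (X t) J.
    by rewrite big1// => i _; case: ifPn => [->|/negPf ->]; rewrite ?subr0.
  have /existsP[i Hi] : [exists i, (i \in X t) != (i \in J)].
    apply/contraT; rewrite negb_exists => /forallP h; case: XJ.
    by apply/setP => i; apply/eqP/negPn; exact: h.
  rewrite (bigD1 i)//= (_ : (if _ then _ else _) = 0) ?mul0r//.
  by move: Hi; case: (i \in J); case: (i \in X t); rewrite //= subrr.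
apply: Linfty_prod => i _; case: (i \in J) => //.
by apply: LinftyB => //; exact: Linfty_cst.
Qed.

(** A finite sum over [J] of the [f J], each cut off by an indicator. This lets matrices whose size
    varies with [t] be studied at a fixed index set. *)
Lemma Linfty_select (f : {set 'I_m} -> R -> R) :
  (forall J, Linfty T (f J)) -> Linfty T (fun t => f (X t) t).
Proof.
move=> fT; have -> : (fun t => f (X t) t) =
    fun t => \sum_J (X t == J)%:R * f J t.
  apply/funext => t; rewrite (bigD1 (X t))//= eqxx mul1r big1 ?addr0// => J.
  by rewrite eq_sym => /negPf ->; rewrite mul0r.
by apply: Linfty_sum => J _; apply: LinftyM => //; exact: Linfty_eq_set.
Qed.

End Linfty_select.

(** * Essentially bounded matrix functions *)

Section Linfty_mx_algebra.
Context (R : realType) (T : R).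

Lemma Linfty_mxD p q (M N : R -> 'M[R]_(p, q)) :
  Linfty_mx T M -> Linfty_mx T N -> Linfty_mx T (fun t => M t + N t).
Proof.
move=> MT NT i j; under eq_fun do rewrite mxE; exact: LinftyD.
Qed.

Lemma Linfty_mxN p q (M : R -> 'M[R]_(p, q)) :
  Linfty_mx T M -> Linfty_mx T (fun t => - M t).
Proof. by move=> MT i j; under eq_fun do rewrite mxE; exact: LinftyN. Qed.

Lemma Linfty_mxZ p q (f : R -> R) (M : R -> 'M[R]_(p, q)) :
  Linfty T f -> Linfty_mx T M -> Linfty_mx T (fun t => f t *: M t).
Proof. by move=> fT MT i j; under eq_fun do rewrite mxE; exact: LinftyM. Qed.

Lemma Linfty_mxM p q r (M : R -> 'M[R]_(p, q)) (N : R -> 'M[R]_(q, r)) :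
  Linfty_mx T M -> Linfty_mx T N -> Linfty_mx T (fun t => M t *m N t).
Proof.
move=> MT NT i j; under eq_fun do rewrite mxE.
by apply: Linfty_sum => k _; exact: LinftyM.
Qed.

Lemma Linfty_trmx p q (M : R -> 'M[R]_(p, q)) :
  Linfty_mx T M -> Linfty_mx T (fun t => (M t)^T).
Proof. by move=> MT i j; under eq_fun do rewrite mxE. Qed.

Lemma Linfty_keep_rows p q (J : {set 'I_p}) (M : R -> 'M[R]_(p, q)) :
  Linfty_mx T M -> Linfty_mx T (fun t => keep_rows (M t) J).
Proof. by move=> MT i j; under eq_fun do rewrite mxE. Qed.

Lemma Linfty_det p (M : R -> 'M[R]_p) :
  Linfty_mx T M -> Linfty T (fun t => \det (M t)).
Proof.
move=> MT; apply: Linfty_sum => s _; apply: LinftyM; first exact: Linfty_cst.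
by apply: Linfty_prod => i _.
Qed.

Lemma Linfty_adj p (M : R -> 'M[R]_p) :
  Linfty_mx T M -> Linfty_mx T (fun t => \adj (M t)).
Proof.
move=> MT i j; under eq_fun do rewrite mxE.
apply: LinftyM; first exact: Linfty_cst.
by apply: Linfty_det => k l; under eq_fun do rewrite !mxE.
Qed.

End Linfty_mx_algebra.

Lemma tr_adj (R : comPzRingType) p (M : 'M[R]_p) : (\adj M)^T = \adj M^T.
Proof.
apply/matrixP => i j; rewrite !mxE /cofactor addnC; congr (_ * _).
by rewrite -det_tr; congr (\det _); apply/matrixP => k l; rewrite !mxE.
Qed.

Lemma dot_colE (R : pzRingType) p (x y : 'cV[R]_p) :
  (x^T *m y) 0 0 = \sum_i x i 0 * y i 0.
Proof. by rewrite mxE; apply: eq_bigr => i _; rewrite mxE. Qed.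

Lemma mul_minr_ge0 (R : realDomainType) (x y : R) :
  0 <= y -> 0 <= x * Num.min x y.
Proof.
move=> y0; case: (leP x y) => xy; first by rewrite -expr2 sqr_ge0.
by rewrite mulr_ge0// (le_trans y0)// ltW.
Qed.

(** If [x <= y] the product is the square of [x]; otherwise [x > y >= 0], so [y] must vanish. For a
    multiplier and its slack, this is the sign condition with complementary slackness. *)
Lemma mul_minr_eq0 (R : realDomainType) (x y : R) : 0 <= y ->
  x * Num.min x y = 0 -> 0 <= x /\ (y != 0 -> x = 0).
Proof.
move=> y0; case: (leP x y) => [_ /eqP|xy].
  by rewrite mulf_eq0 orbb => /eqP ->.
move=> /eqP; rewrite mulf_eq0 => /orP[/eqP x0|/eqP ->].
  by move: xy; rewrite x0 ltNge y0.
by rewrite eqxx; split => //; rewrite (le_trans y0)// ltW.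
Qed.

(** * Projection and descent direction for a fixed matrix *)

Section descent_direction.
Context (R : realFieldType) (k n : nat).
Variables (B : 'M[R]_(k, n)) (c : 'cV[R]_n) (H : 'M[R]_k) (e : 'cV[R]_k).
Hypotheses (GH : B *m B^T *m H = 1%:M) (HT : H^T = H).

Let v := - (H *m B *m c).
Let p := c + B^T *m v.

Lemma mul_residual : B *m p = 0.
Proof. by rewrite mulmxDr !mulmxN !mulmxA GH mul1mx subrr. Qed.

Lemma mul_descent : B *m (B^T *m (H *m e) - p) = e.
Proof. by rewrite mulmxBr mul_residual subr0 !mulmxA GH mul1mx. Qed.

(** The vector [p - c] lies in the range of [B^T], orthogonal to the kernel of [B], so
    [c^T p = p^T p]; symmetry of [H] turns the other term into [- v^T e]. *)
Lemma cost_descent :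
  c^T *m (B^T *m (H *m e) - p) = - (p^T *m p + v^T *m e).
Proof.
have cp : c^T *m p = p^T *m p.
  have -> : p^T = c^T + v^T *m B by rewrite raddfD /= trmx_mul trmxK.
  rewrite mulmxDl.
  by rewrite -(mulmxA v^T) mul_residual mulmx0 addr0.
rewrite mulmxBr cp opprD addrC; congr (_ + _).
by rewrite /v linearN/= !trmx_mul HT mulNmx opprK !mulmxA.
Qed.

End descent_direction.

(** * Multiplier and direction for a fixed index set *)

Section multiplier.
Context (R : realType) (m n : nat) (T K : R).
Variables (A : R -> 'M[R]_(m, n)) (b : R -> 'cV[R]_m) (c : R -> 'cV[R]_n).
Variable zbar : R -> 'cV[R]_n.
Hypotheses (K_gt0 : 0 < K) (AT : Linfty_mx T A) (bT : Linfty_mx T b).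
Hypotheses (cT : Linfty_mx T c) (zT : Linfty_mx T zbar).
Implicit Types (J : {set 'I_m}) (t : R).

Definition gram J t := keep_rows (A t) J *m (keep_rows (A t) J)^T.

(* Equal to the inverse of the Gram matrix wherever its determinant is at least
   K, and essentially bounded everywhere. *)
Definition gram_inv J t := (Num.max (\det (gram J t)) K)^-1 *: \adj (gram J t).

Definition multiplier J t := - (gram_inv J t *m keep_rows (A t) J *m c t).

(** [keep_rows 1%:M J] is the selection matrix of [J]; its transpose extends a vector indexed by [J]
    by zero. *)
Definition multiplier_full J t : 'cV[R]_m :=
  (keep_rows 1%:M J)^T *m multiplier J t.

Definition slack J t := keep_rows (b t - A t *m zbar t) J.

Definition increment J t : 'cV[R]_#|J| :=
  \col_k Num.min (multiplier J t k 0) (slack J t k 0).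

Definition direction J t :=
  (keep_rows (A t) J)^T *m (gram_inv J t *m increment J t)
  - (c t + (keep_rows (A t) J)^T *m multiplier J t).

Lemma Linfty_gram_inv J : Linfty_mx T (gram_inv J).
Proof.
have GT : Linfty_mx T (gram J).
  by apply: Linfty_mxM; [|apply: Linfty_trmx]; exact: Linfty_keep_rows.
apply: Linfty_mxZ; last exact: Linfty_adj.
by apply: Linfty_inv_max => //; exact: Linfty_det.
Qed.

Lemma Linfty_multiplier J : Linfty_mx T (multiplier J).
Proof.
apply: Linfty_mxN; apply: Linfty_mxM => //; apply: Linfty_mxM.
  exact: Linfty_gram_inv.
exact: Linfty_keep_rows.
Qed.

Lemma Linfty_multiplier_full J : Linfty_mx T (multiplier_full J).
Proof.
apply: Linfty_mxM; last exact: Linfty_multiplier.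
by move=> i j; exact: Linfty_cst.
Qed.

Lemma Linfty_direction J : Linfty_mx T (direction J).
Proof.
have BT : Linfty_mx T (fun t => (keep_rows (A t) J)^T).
  by apply: Linfty_trmx; exact: Linfty_keep_rows.
apply: Linfty_mxD.
  apply: Linfty_mxM => //; apply: Linfty_mxM; first exact: Linfty_gram_inv.
  move=> k j; under eq_fun do rewrite mxE.
  apply: Linfty_min; first exact: Linfty_multiplier.
  apply: Linfty_keep_rows; apply: Linfty_mxD => //; apply: Linfty_mxN.
  exact: Linfty_mxM.
apply: Linfty_mxN; apply: Linfty_mxD => //; apply: Linfty_mxM => //.
exact: Linfty_multiplier.
Qed.

(** Where the determinant reaches [K] the truncation is inactive, and the adjugate formula gives the
    inverse. *)
Lemma gramK J t : K <= \det (gram J t) -> gram J t *m gram_inv J t = 1%:M.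
Proof.
move=> Kd; rewrite /gram_inv (max_idPl Kd) -scalemxAr mul_mx_adj.
by rewrite scale_scalar_mx mulVf// gt_eqF// (lt_le_trans K_gt0).
Qed.

Lemma tr_gram_inv J t : (gram_inv J t)^T = gram_inv J t.
Proof. by rewrite linearZ/= tr_adj /gram trmx_mul trmxK. Qed.

Lemma slackE J t k : slack J t k 0 = - residual A b zbar t (enum_val k).
Proof. by rewrite !mxE /residual mxE opprB. Qed.

Lemma keep_rowsM p (x : 'M[R]_(n, p)) J t k j :
  (A t *m x) (enum_val k) j = (keep_rows (A t) J *m x) k j.
Proof. by rewrite !mxE; apply: eq_bigr => l _; rewrite !mxE. Qed.

(** The sum has at most one term, [enum_val] being injective, and none for [i] outside [J]: one
    formula covers both cases. *)
Lemma multiplier_fullE J t i :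
  multiplier_full J t i 0 = \sum_(k | enum_val k == i) multiplier J t k 0.
Proof.
rewrite mxE [RHS]big_mkcond; apply: eq_bigr => k _; rewrite !mxE.
by case: eqP => _; rewrite ?mul1r ?mul0r.
Qed.

Lemma keep_rows_multiplier J t :
  (keep_rows (A t) J)^T *m multiplier J t =
  \sum_i multiplier_full J t i 0 *: (row i (A t))^T.
Proof.
have -> : keep_rows (A t) J = keep_rows 1%:M J *m A t.
  by rewrite /keep_rows -rowsubE.
rewrite trmx_mul -mulmxA -/(multiplier_full J t).
apply/matrixP => i j; rewrite summxE mxE ord1; apply: eq_bigr => l _.
by rewrite !mxE mulrC.
Qed.

Lemma cost_direction J t : K <= \det (gram J t) ->
  ((c t)^T *m direction J t) 0 0 =
  - (\sum_i (c t + (keep_rows (A t) J)^T *m multiplier J t) i 0 ^+ 2 +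
     \sum_k multiplier J t k 0 * Num.min (multiplier J t k 0) (slack J t k 0)).
Proof.
move=> Kd; rewrite /direction (cost_descent _ _ (gramK Kd) (tr_gram_inv J t)).
rewrite mxE mxE !dot_colE.
by congr (- (_ + _)); apply: eq_bigr => k _;
  rewrite ?expr2// [increment _ _ _ _]mxE.
Qed.

Lemma mul_direction J t k : K <= \det (gram J t) ->
  (A t *m direction J t) (enum_val k) 0 =
  Num.min (multiplier J t k 0) (slack J t k 0).
Proof.
by move=> Kd; rewrite keep_rowsM mul_descent ?mxE//; exact: gramK.
Qed.

End multiplier.

(** * From optimality to the multiplier conditions *)

Lemma Linfty_beta_active (R : realType) (m n : nat) (T beta : R)
    (A : R -> 'M[R]_(m, n)) (b : R -> 'cV[R]_m) (z : R -> 'cV[R]_n) i :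
  Linfty_mx T A -> Linfty_mx T b -> Linfty_mx T z ->
  Linfty T (fun t => (i \in beta_active A b z beta t)%:R).
Proof.
move=> AT bT zT.
have rT : Linfty T (fun t => residual A b z t i).
  by apply: LinftyB; [exact: (Linfty_mxM AT zT)|exact: bT].
have := LinftyM (Linfty_ler (Linfty_cst T (- beta)) rT)
                (Linfty_ler rT (Linfty_cst T 0)).
under eq_fun do rewrite -natrM mulnb.
by under [X in _ -> Linfty _ X]eq_fun do rewrite inE.
Qed.

(** By linearity, moving to [zbar + eps w] changes the cost by [eps] times this integral. *)
Lemma optimal_descent_ge0 (R : realType) (m n : nat) (T eps : R)
    (A : R -> 'M[R]_(m, n)) (b : R -> 'cV[R]_m) (c : R -> 'cV[R]_n)
    (zbar w : R -> 'cV[R]_n) :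
  0 < eps -> Linfty_mx T c -> Linfty_mx T w -> optimal T A b c zbar ->
  ae_horizon T (fun t =>
    forall i, (A t *m (zbar t + eps *: w t)) i 0 <= b t i 0) ->
  0 <= \int[leb R]_(t in horizon T) ((c t)^T *m w t) 0 0.
Proof.
move=> eps0 cT wT [[zT _] opt] feas.
have wepsT : Linfty_mx T (fun t => eps *: w t).
  by apply: Linfty_mxZ => //; exact: Linfty_cst.
have /opt : feasible T A b (fun t => zbar t + eps *: w t).
  by split => //; exact: Linfty_mxD.
have ctT := Linfty_trmx cT.
have mD := @measurable_horizon R T.
rewrite /cost.
under [leRHS]eq_Rintegral do
  rewrite mulmxDr -scalemxAr mxE [X in _ + X]mxE.
rewrite RintegralD//; first last.
- apply: Linfty_integrable; apply: LinftyM; first exact: Linfty_cst.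
  exact: (Linfty_mxM ctT wT).
- by apply: Linfty_integrable; exact: (Linfty_mxM ctT zT).
rewrite RintegralZl//; last first.
  by apply: Linfty_integrable; exact: (Linfty_mxM ctT wT).
by rewrite lerDl pmulr_rge0.
Qed.

Theorem theorem3p2 (R : realType) (m n : nat) (T : R)
    (A : R -> 'M[R]_(m, n)) (b : R -> 'cV[R]_m) (c : R -> 'cV[R]_n)
    (zbar : R -> 'cV[R]_n) :
  0 < T ->
  Linfty_mx T A -> Linfty_mx T b -> Linfty_mx T c ->
  optimal T A b c zbar ->
  (exists2 beta : R, 0 < beta & beta_FR T A b zbar beta) ->
  exists u : R -> 'cV[R]_m,
    [/\ Linfty_mx T u,
        ae_horizon T (fun t =>
          c t + \sum_(i in active A b zbar t) u t i 0 *: (row i (A t))^T = 0)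
      & ae_horizon T (fun t => forall i : 'I_m, 0 <= u t i 0)].
Proof.
move=> _ AT bT cT opt [beta beta0 [K K0 FR]].
have [[zT feas] _] := opt.
pose J t := beta_active A b zbar beta t.
have JT i : Linfty T (fun t => (i \in J t)%:R) by exact: Linfty_beta_active.
pose w t := direction K A b c zbar (J t) t.
pose u t := multiplier_full K A c (J t) t.
have wT : Linfty_mx T w.
  move=> i j; apply: (Linfty_select JT
    (f := fun I t => direction K A b c zbar I t i j)).
  by move=> I; exact: Linfty_direction.
have uT : Linfty_mx T u.
  move=> i j; apply: (Linfty_select JT
    (f := fun I t => multiplier_full K A c I t i j)).
  by move=> I; exact: Linfty_multiplier_full.
have {}FR : ae_horizon T (fun t => K <= \det (gram A (J t) t)) by exact: FR.
(* This holds at every time, since beta-activity includes the upper bound 0 on the residual. *)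
have slack_ge0 t k : 0 <= slack A b zbar (J t) t k 0.
  rewrite slackE oppr_ge0.
  by have := enum_valP k; rewrite inE => /andP[].
have [M M0 AwM] := Linfty_mx_bounded (Linfty_mxM AT wT).
(* The bound [eps <= 1] keeps the step within the slack on beta-active rows, and [eps * M <= beta]
   does so on the others; [M + 1] avoids a division by zero. *)
pose eps := Num.min 1 (beta / (M + 1)).
have M1 : 0 < M + 1 by rewrite ltr_wpDl.
have eps0 : 0 < eps by rewrite lt_min ltr01 divr_gt0.
have eps1 : eps <= 1 by rewrite ge_min lexx.
have epsM : eps * M <= beta.
  apply: (@le_trans _ _ (beta / (M + 1) * M)).
    by rewrite ler_wpM2r// ge_min lexx orbT.
  by rewrite -mulrA ler_piMr ?(ltW beta0)// mulrC ler_pdivrMr// mul1r lerDl.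
have feasw : ae_horizon T (fun t =>
    forall i, (A t *m (zbar t + eps *: w t)) i 0 <= b t i 0).
  apply: ae_horizonS2 (ae_horizonS2 _ feas AwM) FR; last first.
    move=> t _ h1 h2; exact: (conj h1 h2).
  move=> t _ [ft Awt] Kd i.
  rewrite mulmxDr -scalemxAr mxE [X in _ + X]mxE -lerBrDl.
  have [iJ|iJ] := boolP (i \in J t).
    rewrite -(enum_rankK_in iJ iJ) mul_direction//.
    set k := enum_rank_in _ _.
    have -> : b t (enum_val k) 0 - (A t *m zbar t) (enum_val k) 0 =
      slack A b zbar (J t) t k 0 by rewrite slackE opprB.
    apply: (@le_trans _ _ (eps * slack A b zbar (J t) t k 0)).
      by rewrite ler_pM2l// ge_min lexx orbT.
    by rewrite ler_piMl.
  (* Off the beta-active set, feasibility leaves only a residual below [- beta]. *)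
  apply: (@le_trans _ _ beta).
    apply: le_trans epsM; rewrite ler_pM2l// (le_trans (ler_norm _))//.
  have := iJ; rewrite inE /residual subr_le0 ft andbT -ltNge => /ltW.
  by rewrite lerNr opprB.
have := optimal_descent_ge0 eps0 cT wT opt feasw.
set q := fun t => ((c t)^T *m w t) 0 0.
move=> Iq.
have qT : Linfty T q by exact: (Linfty_mxM (Linfty_trmx cT) wT).
pose p t := c t + (keep_rows (A t) (J t))^T *m multiplier K A c (J t) t.
have sq_ge0 t : 0 <= \sum_i p t i 0 ^+ 2.
  by apply: sumr_ge0 => i _; exact: sqr_ge0.
have min_ge0 t k : 0 <= multiplier K A c (J t) t k 0 *
    Num.min (multiplier K A c (J t) t k 0) (slack A b zbar (J t) t k 0).
  exact: mul_minr_ge0.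
(* Almost everywhere [- q] is a sum of squares and nonnegative products, while optimality makes its
   integral nonpositive. *)
have q0 : ae_horizon T (fun t => - q t = 0).
  apply: Linfty_ae0; first exact: LinftyN.
    apply: ae_horizonS FR => t _ Kd.
    rewrite /q cost_direction// opprK addr_ge0 ?sq_ge0//.
    by apply: sumr_ge0 => k _; exact: min_ge0.
  have -> : (fun t => - q t) = (fun t => -1 * q t).
    by apply/funext => t; rewrite mulN1r.
  rewrite RintegralZl ?mulN1r ?oppr_le0//; first exact: measurable_horizon.
  exact: Linfty_integrable.
have KKT : ae_horizon T (fun t => p t = 0 /\ forall k,
    0 <= multiplier K A c (J t) t k 0 /\
    (slack A b zbar (J t) t k 0 != 0 -> multiplier K A c (J t) t k 0 = 0)).
  apply: ae_horizonS2 q0 FR => t _ + Kd.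
  rewrite /q cost_direction// opprK => /eqP.
  rewrite paddr_eq0 ?sq_ge0//; last by apply: sumr_ge0 => k _; exact: min_ge0.
  move=> /andP[/eqP p0 /eqP m0]; split.
    apply/matrixP => i j; rewrite ord1 [RHS]mxE.
    have pi0 : p t i 0 ^+ 2 = 0.
      by apply: (psumr_eq0P _ p0) => // l _; exact: sqr_ge0.
    by apply/eqP; rewrite -sqrf_eq0 pi0.
  move=> k; apply: mul_minr_eq0 => //.
  by apply: (psumr_eq0P _ m0) => // l _; exact: min_ge0.
exists u; split => //.
- apply: ae_horizonS KKT => t _ [pt0 ht].
  rewrite -[RHS]pt0 /p keep_rows_multiplier; congr (_ + _).
  (* Inactive indices contribute nothing: those in [J t] have nonzero slack, hence zero multiplier,
     and the others get zero from the extension. *)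
  rewrite [RHS](bigID (mem (active A b zbar t)))/=.
  rewrite [X in _ + X]big1 ?addr0// => i iI.
  rewrite multiplier_fullE big1 ?scale0r// => k /eqP ki.
  apply: (ht k).2; rewrite slackE oppr_eq0 ki.
  by move: iI; rewrite inE.
- apply: ae_horizonS KKT => t _ [_ ht] i.
  by rewrite /u multiplier_fullE sumr_ge0// => k _; case: (ht k).
Qed.
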